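(* Let $\mathcal{R}$ be a $\Phi$-algebra. Then its complexification $\mathcal{A}:=\mathcal{R}\otimes_{\mathbb{R}}\mathbb{C}$, with $^*$-involution and multiplication determined by $(r\otimes\lambda)^*:=r\otimes\overline{\lambda}$ and $(r\otimes\lambda)(s\otimes\mu):=rs\otimes\lambda\mu$ for all $r,s\in\mathcal{R}$ and $\lambda,\mu\in\mathbb{C}$, and with the order on $\mathcal{A}_{\mathrm{H}}=\{r\otimes 1: r\in\mathcal{R}\}\cong\mathcal{R}$ given by that of $\mathcal{R}$, is a commutative $\Phi^*$-algebra. Conversely, if $\mathcal{A}$ is a commutative $\Phi^*$-algebra, then its real unital subalgebra $\mathcal{A}_{\mathrm{H}}$ (with its order) is a $\Phi$-algebra.
   Context: A real vector space with a partial order compatible with addition and multiplication by non-negative scalars is an ordered vector space; it is Archimedean if $v\le\epsilon w$ for fixed $v,w$ and all $\epsilon>0$ implies $v\le 0$; it is a Riesz space if suprema and infima of all pairs of elements exist. A $\Phi$-algebra is an Archimedean Riesz space $\mathcal{R}$ with a multiplication making it a real unital associative algebra such that $rs\in\mathcal{R}^+$ for all $r,s\in\mathcal{R}^+$ and $\inf\{rt,s\}=\inf\{tr,s\}=0$ for all $r,s,t\in\mathcal{R}^+$ with $\inf\{r,s\}=0$, where $\mathcal{R}^+=\{r\in\mathcal{R}: r\ge 0\}$. It is a known fact that $\Phi$-algebras are automatically commutative. A $^*$-algebra is a unital associative complex algebra $\mathcal{A}$ (unit $\mathbb{1}$) with an antilinear involution $a\mapsto a^*$ satisfying $(ab)^*=b^*a^*$;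 $\mathcal{A}_{\mathrm{H}}=\{a\in\mathcal{A}: a=a^*\}$. An ordered $^*$-algebra is a $^*$-algebra $\mathcal{A}$ with a partial order $\le$ on $\mathcal{A}_{\mathrm{H}}$ such that $a+c\le b+c$, $d^*ad\le d^*bd$ and $0\le\mathbb{1}$ for all $a,b,c\in\mathcal{A}_{\mathrm{H}}$ with $a\le b$ and all $d\in\mathcal{A}$; it is Archimedean if the ordered vector space $\mathcal{A}_{\mathrm{H}}$ is. An element $a\in\mathcal{A}_{\mathrm{H}}$ is coercive if $a\ge\epsilon\mathbb{1}$ for some $\epsilon>0$. $\mathcal{A}$ is radical if, whenever $a,b\in\mathcal{A}_{\mathrm{H}}$ commute, $a$ is coercive and $ab\ge 0$, then $b\ge 0$. For $S\subseteq\mathcal{A}$, $S'$ is the commutant and $S''=(S')'$. In a radical Archimedean ordered $^*$-algebra, for commuting $a,b\in\mathcal{A}_{\mathrm{H}}$, $a\vee b$ (resp. $a\wedge b$) is, if it exists, the (necessarily unique) $x\in\{a,b\}''\cap\mathcal{A}_{\mathrm{H}}$ with $x^2+ab=x(a+b)$ and $2x\ge a+b$ (resp. $2x\le a+b$). A $\Phi^*$-algebra is a radical Archimedean ordered $^*$-algebra in which $a\vee b$ and $a\wedge b$ exist for all commuting $a,b\in\mathcal{A}_{\mathrm{H}}$. *)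

(* Defs.v *)
From HB Require Import structures.
From Stdlib Require Import Relation_Definitions.
From mathcomp Require Import all_boot all_order all_algebra.
From mathcomp Require Import complex.
From mathcomp Require Import boolp classical_sets reals.

Set Implicit Arguments.
Unset Strict Implicit.
Unset Printing Implicit Defensive.

Import Order.TTheory GRing.Theory Num.Theory.

Local Open Scope ring_scope.
Local Open Scope complex_scope.
Local Open Scope classical_set_scope.

(* Unital associative algebras over a commutative ring. MathComp's [algType]
   forces [1 != 0], and its hierarchy has no join of [pzRingType] and
   [lmodType]. As the zero algebra is not excluded here, the module axioms are
   restated over [pzRingType]; [ualg_module A] is [A] as an [lmodType]. *)
HB.mixin Record PzRing_isUnitalAlgebra (K : comPzRingType) A
    of GRing.PzRing A := {
  ualg_scale : K -> A -> A;
  ualg_scaleA : forall k l a,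
    ualg_scale k (ualg_scale l a) = ualg_scale (k * l) a;
  ualg_scale1 : left_id 1 ualg_scale;
  ualg_scaleDr : right_distributive ualg_scale +%R;
  ualg_scaleDl : forall a, {morph ualg_scale^~ a : k l / k + l};
  ualg_scaleAl : forall k (a b : A),
    ualg_scale k (a * b) = ualg_scale k a * b;
  ualg_scaleAr : forall k (a b : A),
    ualg_scale k (a * b) = a * ualg_scale k b
}.
#[short(type="unitalAlgType")]
HB.structure Definition UnitalAlgebra (K : comPzRingType) :=
  {A of GRing.PzRing A & PzRing_isUnitalAlgebra K A}.

Reserved Notation "k *:a x" (at level 40, left associativity).
Notation "k *:a x" := (ualg_scale k x) : ring_scope.

Definition ualg_module {K : comPzRingType} (A : unitalAlgType K) : Type := A.

Section UnitalAlgebraModule.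
Context {K : comPzRingType} {A : unitalAlgType K}.

HB.instance Definition _ := GRing.Zmodule.on (ualg_module A).
HB.instance Definition _ := GRing.Zmodule_isLmodule.Build K (ualg_module A)
  (@ualg_scaleA K A) (@ualg_scale1 K A) (@ualg_scaleDr K A)
  (@ualg_scaleDl K A).

Lemma ualg_scaleE k (a : A) : k *:a a = k *: (a : ualg_module A).
Proof. by []. Qed.

Lemma ualg_scale0 (a : A) : (0 : K) *:a a = 0.
Proof. exact: (@scale0r K (ualg_module A)). Qed.
Lemma ualg_scaler0 k : k *:a (0 : A) = 0.
Proof. exact: (@scaler0 K (ualg_module A)). Qed.
Lemma ualg_scaleNl k (a : A) : (- k) *:a a = - (k *:a a).
Proof. exact: (@scaleNr K (ualg_module A)). Qed.
Lemma ualg_scaleNr k (a : A) : k *:a (- a) = - (k *:a a).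
Proof. exact: (@scalerN K (ualg_module A)). Qed.

End UnitalAlgebraModule.

HB.mixin Record UnitalAlgebra_isStarAlgebra (R : realType) A
    of UnitalAlgebra R[i] A := {
  star : A -> A;
  starK : involutive star;
  starD : {morph star : a b / a + b};
  starZ : forall (c : R[i]) (a : A), star (c *:a a) = conjc c *:a star a;
  starM : forall a b : A, star (a * b) = star b * star a
}.
#[short(type="starAlgType")]
HB.structure Definition StarAlgebra (R : realType) :=
  {A of UnitalAlgebra R[i] A & UnitalAlgebra_isStarAlgebra R A}.

#[short(type="comStarAlgType")]
HB.structure Definition ComStarAlgebra (R : realType) :=
  {A of StarAlgebra R A & GRing.ComPzRing A}.

Section Star.
Context {R : realType} {A : starAlgType R}.

Lemma star0 : star (0 : A) = 0.
Proof. by apply: (addrI (star 0)); rewrite -starD !addr0. Qed.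

Lemma starN (a : A) : star (- a) = - star a.
Proof. by apply: (addrI (star a)); rewrite -starD !subrr star0. Qed.

Lemma star1 : star (1 : A) = 1.
Proof. by rewrite -[LHS]mulr1 -[X in _ * X]starK -starM mulr1 starK. Qed.

Definition hermitian : pred A := fun a => a == star a.

Record herm := Herm { herm_val :> A; _ : hermitian herm_val }.
HB.instance Definition _ := [isSub for herm_val].
HB.instance Definition _ := [Choice of herm by <:].

Lemma hermE (a : herm) : star (herm_val a) = herm_val a.
Proof. by case: a => a /= /eqP. Qed.

Fact hermitian_zmod_closed : zmod_closed hermitian.
Proof.
split=> [|a b]; rewrite !unfold_in /hermitian; first by rewrite star0.
by move=> /eqP ha /eqP hb; rewrite starD starN -ha -hb.
Qed.
HB.instance Definition _ := GRing.isZmodClosed.Build A hermitian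
  hermitian_zmod_closed.
HB.instance Definition _ := [SubChoice_isSubZmodule of herm by <:].

Fact herm_scale_subproof (r : R) (a : herm) :
  hermitian (r%:C *:a herm_val a).
Proof.
by rewrite /hermitian starZ hermE /conjc /= oppr0.
Qed.
Definition herm_scale r a := Herm (herm_scale_subproof r a).

Fact herm_scaleA r s a : herm_scale r (herm_scale s a) = herm_scale (r * s) a.
Proof. by apply: val_inj; rewrite /= ualg_scaleA rmorphM. Qed.
Fact herm_scale1 : left_id 1 herm_scale.
Proof. by move=> a; apply: val_inj; rewrite /= ualg_scale1. Qed.
Fact herm_scaleDr : right_distributive herm_scale +%R.
Proof. by move=> r a b; apply: val_inj; rewrite /= ualg_scaleDr. Qed.
Fact herm_scaleDl a : {morph herm_scale^~ a : r s / r + s}.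
Proof. by move=> r s; apply: val_inj; rewrite /= rmorphD ualg_scaleDl. Qed.
HB.instance Definition _ := GRing.Zmodule_isLmodule.Build R herm
  herm_scaleA herm_scale1 herm_scaleDr herm_scaleDl.

Fact herm_unit_subproof : hermitian 1.
Proof. by rewrite /hermitian star1. Qed.
Definition herm_unit := Herm herm_unit_subproof.

Fact herm_conj_subproof (d : A) (a : herm) :
  hermitian (star d * herm_val a * d).
Proof. by rewrite /hermitian !starM starK hermE mulrA. Qed.
Definition herm_conj d a := Herm (herm_conj_subproof d a).

Definition herm_commute (a b : herm) : Prop :=
  herm_val a * herm_val b = herm_val b * herm_val a.

Fact herm_prod_subproof (a b : herm) (ab : herm_commute a b) :
  hermitian (herm_val a * herm_val b).
Proof. by rewrite /hermitian starM !hermE -ab. Qed.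
Definition herm_prod a b (ab : herm_commute a b) :=
  Herm (herm_prod_subproof ab).

Definition commutant (S : set A) : set A :=
  [set a | forall s, S s -> a * s = s * a].

Definition bicommutant (S : set A) : set A := commutant (commutant S).

End Star.
Arguments herm {R} A.
Arguments herm_unit {R} A.

Section HermAlgebra.
Context {R : realType} {A : comStarAlgType R}.
Implicit Types a b c : herm A.

Definition herm_mul a b : herm A :=
  herm_prod (mulrC (herm_val a) (herm_val b)).

Fact herm_mulA : associative herm_mul.
Proof. by move=> a b c; apply: val_inj; rewrite /= mulrA. Qed.
Fact herm_mulC : commutative herm_mul.
Proof. by move=> a b; apply: val_inj; rewrite /= mulrC. Qed.
Fact herm_mul1 : left_id (herm_unit A) herm_mul.
Proof. by move=> a; apply: val_inj; rewrite /= mul1r. Qed.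
Fact herm_mulDl : left_distributive herm_mul +%R.
Proof. by move=> a b c; apply: val_inj; rewrite /= mulrDl. Qed.
HB.instance Definition _ := GRing.Zmodule_isComPzRing.Build (herm A)
  herm_mulA herm_mulC herm_mul1 herm_mulDl.

Fact herm_scaleAl (r : R) a b : r *: (a * b) = (r *: a) * b.
Proof. by apply: val_inj; rewrite /= ualg_scaleAl. Qed.
Fact herm_scaleAr (r : R) a b : r *: (a * b) = a * (r *: b).
Proof. by apply: val_inj; rewrite /= ualg_scaleAr. Qed.
HB.instance Definition _ := PzRing_isUnitalAlgebra.Build R (herm A)
  (@scalerA R (herm A)) (@scale1r R (herm A)) (@scalerDr R (herm A))
  (@scalerDl R (herm A)) herm_scaleAl herm_scaleAr.

End HermAlgebra.

Definition is_sup {T : Type} (le : relation T) (a b x : T) : Prop :=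
  [/\ le a x, le b x & forall y, le a y -> le b y -> le x y].

Definition is_inf {T : Type} (le : relation T) (a b x : T) : Prop :=
  [/\ le x a, le x b & forall y, le y a -> le y b -> le y x].

Section OrderedVectorSpaces.
Context {R : realType} {V : lmodType R}.
Implicit Types (le : relation V) (u v w a b x y : V) (r : R).

Record ordered_vector_space le : Prop := {
  ovs_order : Relation_Definitions.order V le;
  ovs_add : forall u v w, le u v -> le (u + w) (v + w);
  ovs_scale : forall r u v, 0 <= r -> le u v -> le (r *: u) (r *: v)
}.

Definition archimedean le : Prop :=
  forall v w, (forall eps : R, 0 < eps -> le v (eps *: w)) -> le v 0.

Record riesz_space le : Prop := {
  riesz_ovs : ordered_vector_space le;
  riesz_sup : forall a b, exists x, is_sup le a b x;
  riesz_inf : forall a b, exists x, is_inf le a b x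
}.

End OrderedVectorSpaces.

Record phi_algebra {R : realType} {E : unitalAlgType R} (le : relation E)
    : Prop := {
  phi_riesz : @riesz_space R (ualg_module E) le;
  phi_archimedean : @archimedean R (ualg_module E) le;
  phi_mul_ge0 : forall r s : E, le 0 r -> le 0 s -> le 0 (r * s);
  phi_inf_mul : forall r s t : E, le 0 r -> le 0 s -> le 0 t ->
    is_inf le r s 0 -> is_inf le (r * t) s 0 /\ is_inf le (t * r) s 0
}.

Section OrderedStarAlgebras.
Context {R : realType} {A : starAlgType R}.
Implicit Types (le : relation (herm A)) (a b c x : herm A) (d : A).

Record ordered_star_algebra le : Prop := {
  osa_order : Relation_Definitions.order (herm A) le;
  osa_add : forall a b c, le a b -> le (a + c) (b + c);
  osa_conj : forall a b d, le a b -> le (herm_conj d a) (herm_conj d b);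
  osa_unit_ge0 : le 0 (herm_unit A)
}.

Definition coercive le a : Prop :=
  exists2 eps : R, 0 < eps & le (eps *: herm_unit A) a.

Definition radical le : Prop :=
  forall a b (ab : herm_commute a b),
    coercive le a -> le 0 (herm_prod ab) -> le 0 b.

Definition is_vee le a b x : Prop :=
  [/\ bicommutant [set herm_val a; herm_val b] (herm_val x),
      herm_val x ^+ 2 + herm_val a * herm_val b
        = herm_val x * (herm_val a + herm_val b)
    & le (a + b) (x *+ 2)].

Definition is_wedge le a b x : Prop :=
  [/\ bicommutant [set herm_val a; herm_val b] (herm_val x),
      herm_val x ^+ 2 + herm_val a * herm_val b
        = herm_val x * (herm_val a + herm_val b)
    & le (x *+ 2) (a + b)].

Record phi_star_algebra le : Prop := {
  phis_osa : ordered_star_algebra le;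
  phis_archimedean : archimedean le;
  phis_radical : radical le;
  phis_vee : forall a b, herm_commute a b -> exists x, is_vee le a b x;
  phis_wedge : forall a b, herm_commute a b -> exists x, is_wedge le a b x
}.

End OrderedStarAlgebras.

(* [Cplx r s] stands for [r (x) 1 + s (x) 'i]; that this is the tensor product
   of [E] with [R[i]] over [R] is [tens_bilinear] and [tens_universal] below,
   and [tensM], [tens_star] say that the product and the involution are the
   expected ones on elementary tensors. *)
Section Complexification.
Context {R : realType} {E : unitalAlgType R}.

Record complexification := Cplx { cre : E; cim : E }.
Local Notation EC := complexification.
Implicit Types (x y z : EC) (c : R[i]).

Definition cplx_pair x := (cre x, cim x).
Definition pair_cplx (p : E * E) := Cplx p.1 p.2.
Fact cplx_pairK : cancel cplx_pair pair_cplx.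
Proof. by case. Qed.
HB.instance Definition _ := Choice.copy EC (can_type cplx_pairK).

Lemma cplx_eq x y : cre x = cre y -> cim x = cim y -> x = y.
Proof. by case: x y => [? ?] [? ?] /= -> ->. Qed.

Definition cplx_zero := Cplx 0 0.
Definition cplx_opp x := Cplx (- cre x) (- cim x).
Definition cplx_add x y := Cplx (cre x + cre y) (cim x + cim y).
Fact cplx_addA : associative cplx_add.
Proof. by move=> x y z; apply: cplx_eq; rewrite /= addrA. Qed.
Fact cplx_addC : commutative cplx_add.
Proof. by move=> x y; apply: cplx_eq; rewrite /= addrC. Qed.
Fact cplx_add0 : left_id cplx_zero cplx_add.
Proof. by move=> x; apply: cplx_eq; rewrite /= add0r. Qed.
Fact cplx_addN : left_inverse cplx_zero cplx_opp cplx_add.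
Proof. by move=> x; apply: cplx_eq; rewrite /= addNr. Qed.
HB.instance Definition _ := GRing.isZmodule.Build EC
  cplx_addA cplx_addC cplx_add0 cplx_addN.

Definition cplx_one := Cplx 1 0.
Definition cplx_mul x y :=
  Cplx (cre x * cre y - cim x * cim y) (cre x * cim y + cim x * cre y).
Fact cplx_mulA : associative cplx_mul.
Proof.
move=> x y z; apply: cplx_eq;
  rewrite /= !(mulrDr, mulrDl, mulrN, mulNr) !mulrA ?opprD -!addrA;
  by congr (_ + _); rewrite addrA addrC.
Qed.
Fact cplx_mul1 : left_id cplx_one cplx_mul.
Proof. by move=> x; apply: cplx_eq; rewrite /= !mul1r mul0r ?subr0 ?addr0. Qed.
Fact cplx_mulr1 : right_id cplx_one cplx_mul.
Proof. by move=> x; apply: cplx_eq; rewrite /= !mulr1 mulr0 ?subr0 ?add0r. Qed.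
Fact cplx_mulDl : left_distributive cplx_mul +%R.
Proof.
move=> x y z; apply: cplx_eq; rewrite /= !mulrDl ?opprD -!addrA; congr (_ + _);
  by rewrite addrCA.
Qed.
Fact cplx_mulDr : right_distributive cplx_mul +%R.
Proof.
move=> x y z; apply: cplx_eq; rewrite /= !mulrDr ?opprD -!addrA; congr (_ + _);
  by rewrite addrCA.
Qed.
HB.instance Definition _ := GRing.Zmodule_isPzRing.Build EC
  cplx_mulA cplx_mul1 cplx_mulr1 cplx_mulDl cplx_mulDr.

Definition cplx_scale c x :=
  Cplx (complex.Re c *:a cre x - complex.Im c *:a cim x)
       (complex.Re c *:a cim x + complex.Im c *:a cre x).
Fact cplx_scaleA c1 c2 x :
  cplx_scale c1 (cplx_scale c2 x) = cplx_scale (c1 * c2) x.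
Proof.
case: c1 c2 => [a b] [c d]; apply: cplx_eq;
  rewrite /= !(ualg_scaleDr, ualg_scaleDl, ualg_scaleNr, ualg_scaleNl);
  rewrite !ualg_scaleA ?opprD -!addrA; by congr (_ + _); rewrite addrA addrC.
Qed.
Fact cplx_scale1 : left_id (1 : R[i]) cplx_scale.
Proof.
by move=> x; apply: cplx_eq; rewrite /= ualg_scale1 ualg_scale0 ?subr0 ?addr0.
Qed.
Fact cplx_scaleDr : right_distributive cplx_scale +%R.
Proof.
move=> c x y; apply: cplx_eq; rewrite /= !ualg_scaleDr ?opprD -!addrA;
  congr (_ + _); by rewrite addrCA.
Qed.
Fact cplx_scaleDl x : {morph cplx_scale^~ x : c1 c2 / c1 + c2}.
Proof.
move=> [a b] [c d]; apply: cplx_eq; rewrite /= !ualg_scaleDl ?opprD -!addrA;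
  congr (_ + _); by rewrite addrCA.
Qed.
Fact cplx_scaleAl c x y : cplx_scale c (x * y) = cplx_scale c x * y.
Proof.
apply: cplx_eq; rewrite /= !(ualg_scaleDr, ualg_scaleNr, mulrDl, mulNr);
  rewrite -!ualg_scaleAl ?opprD -!addrA; by congr (_ + _); rewrite addrA addrC.
Qed.
Fact cplx_scaleAr c x y : cplx_scale c (x * y) = x * cplx_scale c y.
Proof.
apply: cplx_eq; rewrite /= !(ualg_scaleDr, ualg_scaleNr, mulrDr, mulrN);
  rewrite -!ualg_scaleAr ?opprD -!addrA; by congr (_ + _); rewrite addrCA.
Qed.
HB.instance Definition _ := PzRing_isUnitalAlgebra.Build R[i] EC
  cplx_scaleA cplx_scale1 cplx_scaleDr cplx_scaleDl cplx_scaleAl cplx_scaleAr.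

Definition cplx_star x := Cplx (cre x) (- cim x).
Fact cplx_starK : involutive cplx_star.
Proof. by move=> x; apply: cplx_eq; rewrite /= ?opprK. Qed.
Fact cplx_starD : {morph cplx_star : x y / x + y}.
Proof. by move=> x y; apply: cplx_eq; rewrite /= ?opprD. Qed.
Fact cplx_starZ c x : cplx_star (c *:a x) = conjc c *:a cplx_star x.
Proof.
by case: c => a b; apply: cplx_eq;
  rewrite /= ?ualg_scaleNr ?ualg_scaleNl ?opprD ?opprK.
Qed.

(* The elementary tensor [r (x) c]. *)
Definition tens (r : E) c : EC :=
  Cplx (complex.Re c *:a r) (complex.Im c *:a r).

Lemma tensM r s c d : tens r c * tens s d = tens (r * s) (c * d).
Proof.
case: c d => [a b] [c d]; apply: cplx_eq; rewrite /= !ualg_scaleDl ?ualg_scaleNl;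
  by rewrite -!ualg_scaleAl -!ualg_scaleAr !ualg_scaleA.
Qed.

Lemma tens_star r c : cplx_star (tens r c) = tens r (conjc c).
Proof. by case: c => a b; apply: cplx_eq; rewrite //= ualg_scaleNl. Qed.

Lemma tensZ r c d : d *:a tens r c = tens r (d * c).
Proof.
case: c d => [a b] [c d]; apply: cplx_eq;
  by rewrite /= ualg_scaleDl ?ualg_scaleNl !ualg_scaleA.
Qed.

Lemma cplx_starE x : cplx_star x = x <-> exists r, x = tens r 1.
Proof.
split=> [sx|[r ->]]; last by rewrite tens_star /conjc /= oppr0.
exists (cre x); apply: cplx_eq; rewrite /= ?ualg_scale1 // ualg_scale0.
have /(congr1 cim) /= h := sx.
have h2 : 2%:R *:a cim x = (0 : E).
  by rewrite mulr2n ualg_scaleDl ualg_scale1 -{1}h addNr.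
rewrite -[cim x](@ualg_scale1 R) -(mulVf (_ : 2%:R != 0 :> R)) ?pnatr_eq0 //.
by rewrite -ualg_scaleA h2 ualg_scaler0.
Qed.

Lemma tens_bilinear :
  [/\ forall c, {morph tens^~ c : r s / r + s},
      forall r, {morph tens r : c d / c + d}
    & forall (k : R) r c, tens (k *:a r) c = k%:C *:a tens r c
                       /\ tens r (k%:C * c) = k%:C *:a tens r c].
Proof.
split=> [c r s|r [a b] [c d]|k r [a b]].
- by apply: cplx_eq; rewrite /= ualg_scaleDr.
- by apply: cplx_eq; rewrite /= ualg_scaleDl.
- split; last by rewrite tensZ.
  by rewrite tensZ; apply: cplx_eq;
    rewrite /= ualg_scaleA !mul0r ?subr0 ?addr0 mulrC.
Qed.

Lemma tens_universal (X : lmodType R) (f : E -> R[i] -> X) :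
    (forall c, {morph f^~ c : r s / r + s}) ->
    (forall r, {morph f r : c d / c + d}) ->
    (forall (k : R) r c, f (k *:a r) c = k *: f r c
                      /\ f r (k%:C * c) = k *: f r c) ->
  exists! g : EC -> X,
    [/\ {morph g : x y / x + y},
        forall (k : R) x, g (k%:C *:a x) = k *: g x
      & forall r c, g (tens r c) = f r c].
Proof.
move=> fDl fDr fZ.
have cE (c : R[i]) : c = (complex.Re c)%:C * 1 + (complex.Im c)%:C * 'i%C.
  by case: c => a b; apply/eqP; rewrite eq_complex /= !(mulr0, mulr1, mul0r,
    subr0, addr0, add0r) !eqxx.
have xE x : x = tens (cre x) 1 + tens (cim x) 'i%C.
  by apply: cplx_eq; rewrite /= !ualg_scale1 !ualg_scale0 ?addr0 ?add0r.
exists (fun x => f (cre x) 1 + f (cim x) 'i%C); split.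
  split=> [x y|k x|r c].
  - by rewrite /= fDl fDl addrACA.
  - by rewrite /= !ualg_scale0 subr0 addr0 !(fZ _ _ _).1 scalerDr.
  - by rewrite /= !(fZ _ _ _).1 -!(fZ _ _ _).2 -fDr -cE.
move=> g [gD gZ gt]; apply/funext => x.
by rewrite [in RHS](xE x) gD !gt.
Qed.

(* The involution is antimultiplicative only when [E] is commutative, so this
   property is a parameter of the star-algebra structure. *)
Definition cplx_star_antimorph : Prop :=
  forall x y : EC, cplx_star (x * y) = cplx_star y * cplx_star x.

Definition cplx_starAlg (starM : cplx_star_antimorph) : starAlgType R :=
  HB.pack EC (UnitalAlgebra_isStarAlgebra.Build R EC
    cplx_starK cplx_starD cplx_starZ starM).

End Complexification.
Arguments complexification {R} E.
Arguments cplx_star_antimorph {R} E.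

Definition cplx_le {R : realType} {E : unitalAlgType R} (le : relation E)
    (starM : cplx_star_antimorph E) : relation (herm (cplx_starAlg starM)) :=
  fun x y => le (cre (herm_val x)) (cre (herm_val y)).

Arguments cplx_le {R E} le starM.

Section ComplexificationOrder.
Context {R : realType} {E : unitalAlgType R}.
Context {starM : cplx_star_antimorph E}.

Fact tens_herm_subproof (r : E) :
  hermitian (tens r 1 : cplx_starAlg starM).
Proof. by apply/eqP/esym/cplx_starE; exists r. Qed.
Definition tens_herm r : herm (cplx_starAlg starM) :=
  Herm (tens_herm_subproof r).

Lemma tens_herm_surj x : exists r, x = tens_herm r.
Proof.
have /cplx_starE[r xr] := hermE x.
by exists r; apply: val_inj.
Qed.

Lemma tens_herm_le (le : relation E) r s :
  cplx_le le starM (tens_herm r) (tens_herm s) <-> le r s.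
Proof. by rewrite /cplx_le /= !ualg_scale1. Qed.

End ComplexificationOrder.

(* Main.v *)
Require Import Defs.
From Stdlib Require Import Relation_Definitions.
From mathcomp Require Import all_boot all_order all_algebra.
From mathcomp Require Import reals.
From mathcomp Require Import boolp ring.

Set Implicit Arguments.
Unset Strict Implicit.
Unset Printing Implicit Defensive.

Import Order.TTheory GRing.Theory Num.Theory.

Local Open Scope ring_scope.

(** Commutativity of a Phi-algebra: for [a >= 0] the map [S u = a u + u a] is a
    lattice homomorphism, and [[a, x] = [a, x - k] <= S |x - k|] for every
    integer [k].  Hence [[a, x] <= S (inf_(k <= n) |x - k|)
    <= S (1 + (x - n)^+) <= 2 a + S (x ^ 2) / n], so that [[a, x] <= 2 a] by the
    Archimedean property.  Replacing [x] by its multiples gives [[a, x] <= 0].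
    The supremum [x] of [a] and [b] satisfies [(x - a) (x - b) = 0], which is
    the equation that defines [a \/ b].

    Conversely, radicality, squares and the Archimedean property show that
    [w >= 0] as soon as [s >= 0] and [s w >= w ^ 2].  Applied to
    [s = (x - a) + (x - b)], and to [s = (y - a) + (y - b)], [w = y - x] for an
    upper bound [y], this shows that [a \/ b] is a supremum, so the Hermitian
    part is a Riesz space in which disjointness amounts to a zero product. *)

(** * Suprema and infima in partially ordered abelian groups *)

Section OrderedGroup.
Context {V : zmodType} {le : relation V}.
Hypothesis le_order : Relation_Definitions.order V le.
Hypothesis le_add : forall x y z, le x y -> le (x + z) (y + z).
Implicit Types a b c x y z : V.

Lemma ogle_refl x : le x x. Proof. by case: le_order => /(_ x). Qed.
Lemma ogle_trans y x z : le x y -> le y z -> le x z.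
Proof. by case: le_order => _ /(_ x y z). Qed.
Lemma ogle_anti x y : le x y -> le y x -> x = y.
Proof. by case: le_order => _ _ /(_ x y). Qed.

Lemma ogleD2r z x y : le (x + z) (y + z) <-> le x y.
Proof. by split=> [/(le_add (- z))|/le_add]; rewrite ?addrK; apply. Qed.
Lemma ogleD2l z x y : le (z + x) (z + y) <-> le x y.
Proof. by rewrite ![z + _]addrC; exact: ogleD2r. Qed.
Lemma ogleD a b x y : le a b -> le x y -> le (a + x) (b + y).
Proof. by move=> /(ogleD2r x) ab /(ogleD2l b); apply: ogle_trans. Qed.
Lemma ogleBlr z x y : le (x - z) y <-> le x (y + z).
Proof. by rewrite -(ogleD2r z) subrK. Qed.
Lemma ogsubr_ge0 x y : le 0 (y - x) <-> le x y.
Proof. by rewrite -(ogleD2r x) add0r subrK. Qed.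
Lemma ogleN2 x y : le (- x) (- y) <-> le y x.
Proof. by rewrite -ogsubr_ge0 opprK addrC ogsubr_ge0. Qed.
Lemma ogaddr_ge0 x y : le 0 x -> le 0 y -> le 0 (x + y).
Proof. by rewrite -[X in le X (x + y)]addr0; apply: ogleD. Qed.
Lemma ogler_wDr x y : le 0 y -> le x (x + y).
Proof. by rewrite -(ogleD2l x) addr0. Qed.

Lemma is_inf_sym a b x : is_inf le a b x -> is_inf le b a x.
Proof. by case=> xa xb glb; split=> // y yb ya; apply: glb. Qed.

Lemma is_inf_uniq a b x y : is_inf le a b x -> is_inf le a b y -> x = y.
Proof.
move=> [xa xb xglb] [ya yb yglb].
by apply: ogle_anti; [apply: yglb | apply: xglb].
Qed.

Lemma is_inf_oppr a b x : is_sup le (- a) (- b) (- x) -> is_inf le a b x.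
Proof.
move=> [/ogleN2 xa /ogleN2 xb lub]; split=> // y ya yb.
by apply/ogleN2/lub; apply/ogleN2.
Qed.

Lemma is_inf_subr a b x c :
  is_inf le a b x -> is_inf le (a - c) (b - c) (x - c).
Proof.
move=> [xa xb glb]; split=> [||y]; rewrite ?ogleD2r //.
rewrite -{1 2}(addrK c y) !ogleD2r => ya yb.
by rewrite -(addrK c y) ogleD2r; apply: glb.
Qed.

(** If [y] is below [r + r'] and [s], then [y - r'] is below [r] and [s], hence below [0]; so [y] is
    below both [r'] and [s]. *)
Lemma is_inf_addl0 r r' s : le 0 r -> le 0 r' ->
  is_inf le r s 0 -> is_inf le r' s 0 -> is_inf le (r + r') s 0.
Proof.
move=> r0 r'0 [_ s0 glb] [_ _ glb']; split=> // [|y yr ys].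
  exact: ogaddr_ge0.
have : le (y - r') 0.
  by apply: glb; apply/ogleBlr => //; apply/(ogle_trans ys)/ogler_wDr.
by move=> /ogleBlr; rewrite add0r => yr'; apply: glb'.
Qed.

(** If [y] bounds [a] and [b] from above, then [a + b - y] bounds them from below. *)
Lemma is_sup_of_inf a b x : is_inf le a b x -> is_sup le a b (a + b - x).
Proof.
move=> [xa xb glb]; split=> [||y ay yb].
- by rewrite -addrA; apply/ogler_wDr/ogsubr_ge0.
- by rewrite addrAC addrC; apply/ogler_wDr/ogsubr_ge0.
- apply/ogleBlr; rewrite [y + x]addrC; apply/ogleBlr; apply: glb; apply/ogleBlr.
    by apply/ogleD2l.
  by rewrite [a + b]addrC; apply/ogleD2l.
Qed.

Lemma is_inf_sup_sub a b x : is_sup le a b x -> is_inf le (x - a) (x - b) 0.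
Proof.
move=> [ax bx lub]; split=> [||y ya yb]; rewrite ?ogsubr_ge0 //.
rewrite -[y]opprK -oppr0 ogleN2 -(ogleD2l x) addr0.
by apply: lub; rewrite -ogsubr_ge0 addrAC ogsubr_ge0.
Qed.

End OrderedGroup.

(** * Hermitian elements of a commutative Phi-star-algebra *)

Section CommutativePhiStar.
Context {R : realType} {A : comStarAlgType R} {le : relation (herm A)}.
Hypothesis phi : phi_star_algebra le.
Implicit Types a b c x y u v w s t : herm A.

Let ord := osa_order (phis_osa phi).
Let add := osa_add (phis_osa phi).
#[local] Notation trans := (ogle_trans ord).
#[local] Notation addr_ge0 := (ogaddr_ge0 ord add).

(** Turns the conjugation axiom into monotonicity of multiplication by squares. *)
Lemma herm_mul_conj a b : herm_conj (herm_val a) b = a * a * b.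
Proof. by apply: val_inj; rewrite /= hermE mulrAC. Qed.

Lemma phis_conj_ge0 a b : le 0 b -> le 0 (a * a * b).
Proof.
move=> /(osa_conj (phis_osa phi) (herm_val a)).
by rewrite !herm_mul_conj mulr0.
Qed.

Lemma phis_sqr_ge0 a : le 0 (a ^+ 2).
Proof.
rewrite expr2 -[a * a]mulr1; apply: phis_conj_ge0.
exact: osa_unit_ge0 (phis_osa phi).
Qed.

(** Scaling by [r] is conjugation by [Num.sqrt r] times the unit. *)
Lemma phis_scale_ge0 (r : R) a : 0 <= r -> le 0 a -> le 0 (r *: a).
Proof.
move=> r0 a0.
set q := Num.sqrt r *: (1 : herm A); suff -> : r *: a = q * q * a.
  exact: phis_conj_ge0.
by rewrite /q -!herm_scaleAl mul1r -herm_scaleAl mul1r scalerA -expr2 sqr_sqrtr.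
Qed.

Lemma phis_coercive_cancel (eps : R) a b :
  0 < eps -> le (eps *: (1 : herm A)) a -> le 0 (a * b) -> le 0 b.
Proof.
move=> eps0 epsa; apply: (phis_radical phi (ab := mulrC _ _)).
by exists eps.
Qed.

Lemma phis_ge0_of_eps a b :
  (forall eps : R, 0 < eps -> le 0 (b + eps *: a)) -> le 0 b.
Proof.
move=> h; apply/(ogleN2 add); rewrite oppr0.
apply: (phis_archimedean phi) => eps eps0; apply/(ogsubr_ge0 add).
by rewrite opprK addrC; apply: h.
Qed.

Lemma phis_eps_ge0 (eps : R) : 0 < eps -> le 0 (eps *: (1 : herm A)).
Proof.
move=> /ltW eps0; apply: phis_scale_ge0 => //.
exact: osa_unit_ge0 (phis_osa phi).
Qed.

Lemma phis_le_addeps (eps : R) a :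
  le 0 a -> le (eps *: (1 : herm A)) (a + eps *: (1 : herm A)).
Proof. by move=> a0; rewrite addrC; exact: (ogler_wDr add). Qed.

(* [(a + eps) ((a + eps) b)] is a square times [b], and [a + eps] is coercive,
   so [(a + eps) b] is positive. *)
Lemma phis_mul_ge0 a b : le 0 a -> le 0 b -> le 0 (a * b).
Proof.
move=> a0 b0; apply: (@phis_ge0_of_eps b) => eps eps0.
apply: (phis_coercive_cancel eps0 (phis_le_addeps eps a0)).
have -> : a * b + eps *: b = (a + eps *: (1 : herm A)) * b.
  by rewrite mulrDl -herm_scaleAl mul1r.
by rewrite mulrA; apply: phis_conj_ge0.
Qed.

Lemma phis_ge0_of_sqr_le s w :
  le 0 s -> le 0 (s * w - w ^+ 2) -> le 0 w.
Proof.
move=> s0 sw; apply: (@phis_ge0_of_eps 1) => eps eps0.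
(* The factor 4 completes the square [(w + e *+ 2) ^+ 2] in the identity below. *)
have eps40 : 0 < eps *+ 4 by rewrite pmulrn_rgt0.
apply: (phis_coercive_cancel eps40 (phis_le_addeps (eps *+ 4) s0)).
rewrite -scalerMnl; set e := eps *: (1 : herm A).
have -> : (s + e *+ 4) * (w + e) = (s * w - w ^+ 2) + (w + e *+ 2) ^+ 2 + e * s.
  by ring.
apply: addr_ge0; last exact/phis_mul_ge0/s0/phis_eps_ge0.
by apply: addr_ge0 => //; apply: phis_sqr_ge0.
Qed.

Lemma phis_is_sup a b x :
  (x - a) * (x - b) = 0 -> le (a + b) (x *+ 2) -> is_sup le a b x.
Proof.
move=> xab0 /(ogsubr_ge0 add) x2.
have xabE : x *+ 2 - (a + b) = (x - a) + (x - b) by ring.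
rewrite xabE in x2.
split=> [||y /(ogsubr_ge0 add) ya /(ogsubr_ge0 add) yb];
  apply/(ogsubr_ge0 add).
- apply: (phis_ge0_of_sqr_le x2).
  rewrite [X in le 0 X](_ : _ = (x - a) * (x - b)); last by ring.
  by rewrite xab0; exact: (ogle_refl ord).
- apply: (phis_ge0_of_sqr_le x2).
  rewrite [X in le 0 X](_ : _ = (x - a) * (x - b)); last by ring.
  by rewrite xab0; exact: (ogle_refl ord).
- apply: (phis_ge0_of_sqr_le (addr_ge0 ya yb)).
  rewrite [X in le 0 X](_ : _ = (y - a) * (y - b) - (x - a) * (x - b));
    last by ring.
  by rewrite xab0 subr0; apply: phis_mul_ge0.
Qed.

Lemma phis_is_inf a b x :
  (x - a) * (x - b) = 0 -> le (x *+ 2) (a + b) -> is_inf le a b x.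
Proof.
move=> xab0 x2; apply: (is_inf_oppr add).
apply: phis_is_sup; last by rewrite -opprD mulNrn; apply/(ogleN2 add).
by rewrite -xab0; ring.
Qed.

Lemma herm_quadratic a b x :
  herm_val x ^+ 2 + herm_val a * herm_val b
    = herm_val x * (herm_val a + herm_val b) ->
  (x - a) * (x - b) = 0.
Proof.
move=> e; have {}e : x ^+ 2 + a * b = x * (a + b) by apply: val_inj.
have -> : (x - a) * (x - b) = x ^+ 2 + a * b - x * (a + b) by ring.
by rewrite e subrr.
Qed.

Lemma phis_wedge_quadratic a b :
  exists2 x, (x - a) * (x - b) = 0 & is_inf le a b x.
Proof.
have [x [_ /herm_quadratic xab x2]] := phis_wedge phi (mulrC (val a) (val b)).
by exists x => //; apply: phis_is_inf.
Qed.

(** By uniqueness of infima the wedge of [r] and [s] is [0], so its quadratic equation reads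
    [r * s = 0]. Then [(r * t) * s = 0], which for positive elements gives back disjointness. *)
Lemma phis_inf_mul r s t : le 0 r -> le 0 s -> le 0 t ->
  is_inf le r s 0 -> is_inf le (r * t) s 0.
Proof.
move=> r0 s0 t0 rs0.
have [x xrs /(is_inf_uniq ord rs0) x0] := phis_wedge_quadratic r s.
rewrite -x0 !sub0r mulrNN in xrs.
apply: phis_is_inf; first by rewrite !sub0r mulrNN mulrAC xrs mul0r.
by rewrite mul0rn; apply: addr_ge0 => //; apply: phis_mul_ge0.
Qed.

Lemma phi_algebra_herm : phi_algebra le.
Proof.
split; [split|exact: (phis_archimedean phi)|exact: phis_mul_ge0|].
- split=> // k u v k0 /(ogsubr_ge0 add) uv.
  apply/(ogsubr_ge0 add); rewrite -[_ - _](@scalerBr R (herm A)).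
  exact: phis_scale_ge0.
- move=> a b; have [x _ /(is_sup_of_inf add)] := phis_wedge_quadratic a b.
  by exists (a + b - x).
- by move=> a b; have [x _ ?] := phis_wedge_quadratic a b; exists x.
- move=> r s t r0 s0 t0 rs; rewrite [t * r]mulrC.
  by split; apply: phis_inf_mul.
Qed.

End CommutativePhiStar.

(** * Positive parts, squares and nilpotents in a Phi-algebra *)

Section PhiAlgebra.
Context {R : realType} {E : unitalAlgType R} {le : relation E}.
Hypothesis phi : phi_algebra le.
Implicit Types a b r s u v x y : E.

Let ovs := riesz_ovs (phi_riesz phi).
Let ord : Relation_Definitions.order E le := ovs_order ovs.
Let add : forall x y z : E, le x y -> le (x + z) (y + z) := ovs_add ovs.
#[local] Notation refl := (ogle_refl ord).
#[local] Notation trans := (ogle_trans ord).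
#[local] Notation addr_ge0 := (ogaddr_ge0 ord add).
#[local] Notation subr_ge0 := (ogsubr_ge0 add).

Lemma phi_mono_scale (k : R) x y : 0 <= k -> le x y -> le (k *:a x) (k *:a y).
Proof. exact: (ovs_scale ovs). Qed.

Lemma phi_scale_ge0 (k : R) x : 0 <= k -> le 0 x -> le 0 (k *:a x).
Proof. by move=> k0 /(phi_mono_scale k0); rewrite ualg_scaler0. Qed.

Lemma phi_arch x y : (forall eps : R, 0 < eps -> le x (eps *:a y)) -> le x 0.
Proof. exact: (phi_archimedean phi). Qed.

Lemma phi_ler_wM2l a x y : le 0 a -> le x y -> le (a * x) (a * y).
Proof.
move=> a0 /subr_ge0 xy; apply/subr_ge0; rewrite -mulrBr.
exact: (phi_mul_ge0 phi a0 xy).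
Qed.

Lemma phi_ler_wM2r a x y : le 0 a -> le x y -> le (x * a) (y * a).
Proof.
move=> a0 /subr_ge0 xy; apply/subr_ge0; rewrite -mulrBl.
exact: (phi_mul_ge0 phi xy a0).
Qed.

Definition pospart x : E := sval (cid (riesz_sup (phi_riesz phi) x 0)).

Lemma pospart_sup x : is_sup le x 0 (pospart x).
Proof. exact: svalP (cid (riesz_sup (phi_riesz phi) x 0)). Qed.

Lemma pospart_ge x : le x (pospart x). Proof. by case: (pospart_sup x). Qed.
Lemma pospart_ge0 x : le 0 (pospart x). Proof. by case: (pospart_sup x). Qed.
Lemma pospart_lub x y : le x y -> le 0 y -> le (pospart x) y.
Proof. by case: (pospart_sup x) => _ _; apply. Qed.
#[local] Hint Resolve pospart_ge pospart_ge0 : core.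

Lemma pospartB x : pospart x - pospart (- x) = x.
Proof.
apply/eqP; rewrite subr_eq; apply/eqP/(ogle_anti ord).
  apply: pospart_lub; first exact: (ogler_wDr add).
  by rewrite -{1}(subrr x); apply/(ogleD2l add).
rewrite addrC -[X in le _ X](subrK x); apply/(ogleD2r add).
apply: pospart_lub; last exact/subr_ge0.
by rewrite -[X in le X _]add0r; apply/(ogleD2r add).
Qed.

Lemma pospart_disj x : is_inf le (pospart x) (pospart (- x)) 0.
Proof.
split=> // y yp yn; rewrite -[y]opprK -oppr0; apply/(ogleN2 add).
rewrite -(ogleD2l add (pospart x)) addr0; apply: pospart_lub.
  rewrite -{1}(pospartB x); apply/(ogleD2l add); exact/(ogleN2 add).
exact/subr_ge0.
Qed.

(** Multiplying one entry by [s], then the other by [r], keeps the infimum [0] and makes [r * s]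
    disjoint from itself. *)
Lemma phi_disj_mul r s : is_inf le r s 0 -> r * s = 0.
Proof.
move=> rs; have [r0 s0 _] := rs.
have [/is_inf_sym srs _] := phi_inf_mul phi r0 s0 s0 rs.
have [_ [_ _ glb]] := phi_inf_mul phi s0 (phi_mul_ge0 phi r0 s0) r0 srs.
by apply: (ogle_anti ord); [apply: glb; exact: refl | exact: (phi_mul_ge0 phi)].
Qed.

Lemma pospartMN x : pospart x * pospart (- x) = 0.
Proof. exact/phi_disj_mul/pospart_disj. Qed.

Lemma pospartNM x : pospart (- x) * pospart x = 0.
Proof. exact/phi_disj_mul/is_inf_sym/pospart_disj. Qed.

Lemma phi_sqr_ge0 x : le 0 (x * x).
Proof.
rewrite -{1 2}(pospartB x) mulrBl !mulrBr pospartMN pospartNM sub0r subr0 opprK.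
by apply: addr_ge0; apply: (phi_mul_ge0 phi).
Qed.

Lemma phi_ler01 : le 0 1.
Proof. by rewrite -[1]mulr1; exact: phi_sqr_ge0. Qed.

Lemma phi_natr_ge0 n : le 0 n%:R.
Proof.
elim: n => [|n IH]; first exact: refl.
by rewrite -natr1; apply: (addr_ge0 IH phi_ler01).
Qed.

(** The multiple [y = eps^-1 *:a x] also has square zero, so [1 - y = (1 - y)^2 + y >= 0]. Thus
    [x <= eps] for every [eps > 0]. *)
Lemma phi_sqr_eq0 x : le 0 x -> x * x = 0 -> x = 0.
Proof.
move=> x0 xx; apply: (ogle_anti ord _ x0).
apply: (@phi_arch _ 1) => eps eps0.
set y := eps^-1 *:a x.
have y0 : le 0 y by apply: (phi_scale_ge0 _ x0); rewrite invr_ge0 ltW.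
have yy : y * y = 0 by rewrite /y -ualg_scaleAl -ualg_scaleAr xx !ualg_scaler0.
have y1 : le y 1.
  apply/subr_ge0; have := addr_ge0 (phi_sqr_ge0 (1 - y)) y0.
  by rewrite mulrBl mul1r mulrBr mulr1 yy subr0 subrK.
have -> : x = eps *:a y by rewrite ualg_scaleA mulfV ?gt_eqF // ualg_scale1.
exact: (phi_mono_scale (ltW eps0) y1).
Qed.

(** * Commutativity of the multiplication *)

(* [u |-> a u + u a] is a lattice homomorphism. *)
Lemma phi_anticomm_inf a v u1 u2 m : le 0 a -> is_inf le u1 u2 m ->
  le v (a * u1 + u1 * a) -> le v (a * u2 + u2 * a) -> le v (a * m + m * a).
Proof.
move=> a0 /(is_inf_subr add m); rewrite subrr => dm vu1 vu2.
have [r0 s0 _] := dm.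
have left r s : is_inf le r s 0 -> is_inf le (a * r + r * a) s 0.
  move=> rs; have [{}r0 {}s0 _] := rs.
  have [ra ar] := phi_inf_mul phi r0 s0 a0 rs.
  have [ra0 _ _] := ra; have [ar0 _ _] := ar.
  exact: (is_inf_addl0 ord add ar0 ra0 ar ra).
(* Applying [left] to each entry makes the images of [u1 - m] and [u2 - m] disjoint;
   [v - (a * m + m * a)] is below both. *)
have /left /is_inf_sym [_ _ glb] := is_inf_sym (left _ _ dm).
rewrite -[a * m + m * a]add0r; apply/(ogleBlr add); apply: glb;
  by rewrite mulrBr mulrBl addrACA -opprD; apply/(ogleD2r add).
Qed.

Definition abspart x : E := pospart x + pospart (- x).

Lemma ler_abspart x : le x (abspart x).
Proof.
rewrite -{1}[x]pospartB; apply/(ogleD2l add)/(trans _ (pospart_ge0 _)).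
by rewrite -oppr0; apply/(ogleN2 add).
Qed.

Lemma lerN_abspart x : le (- x) (abspart x).
Proof. by have := ler_abspart (- x); rewrite /abspart opprK addrC. Qed.

(** Integers are central, so [x] may be shifted by [n%:R] inside the commutator; each of its two
    terms is then bounded separately. *)
Lemma phi_commutator_abs a x (n : nat) : le 0 a ->
  le (a * x - x * a) (a * abspart (x - n%:R) + abspart (x - n%:R) * a).
Proof.
move=> a0; have -> : a * x - x * a = a * (x - n%:R) + (- (x - n%:R)) * a.
  by rewrite mulrBr opprB mulrBl mulr_natl mulr_natr addrA addrNK.
apply: (ogleD ord add).
  exact: (phi_ler_wM2l a0 (ler_abspart _)).
exact: (phi_ler_wM2r a0 (lerN_abspart _)).
Qed.

(* The infimum of [`|x - k|] over [k <= n] is at most [1 + (x - n)^+]. *)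
Lemma phi_commutator_grid a x (n : nat) : le 0 a -> le 0 x ->
  exists2 u, le (a * x - x * a) (a * u + u * a) & le u (1 + pospart (x - n%:R)).
Proof.
move=> a0 x0; elim: n => [|n [u comm_u u_le]].
  exists (abspart (x - 0%:R)); first exact: phi_commutator_abs.
  (* Since [x >= 0], the negative part of [x] is at most [0], hence at most [1]. *)
  rewrite subr0 /abspart addrC; apply/(ogleD2r add)/(trans _ phi_ler01).
  by apply: pospart_lub; [rewrite -oppr0; apply/(ogleN2 add) | exact: refl].
have [m um] := riesz_inf (phi_riesz phi) u (abspart (x - n.+1%:R)).
exists m.
  exact: (phi_anticomm_inf a0 um comm_u (phi_commutator_abs _ _ a0)).
have [mu mz _] := um.
set y := x - n%:R in u_le; set z := x - n.+1%:R in mz *.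
have zE : z = y - 1 by rewrite /z /y -natr1 opprD addrA.
(* It suffices that [m - (1 + pospart z)] is below both parts of [y]. For the positive part use
   [m <= u <= 1 + pospart y]; for the negative one use [m <= abspart z] and
   [- z = 1 - y <= 1 + pospart (- y)]. *)
have [_ _ glb] := pospart_disj y.
rewrite -[X in le _ X]add0r; apply/(ogleBlr add); apply: glb.
  apply/(ogleBlr add)/(trans mu)/(trans u_le).
  rewrite [1 + pospart z]addrC addrA [X in le X _]addrC; apply/(ogleD2r add).
  exact: (ogler_wDr add).
apply/(ogleBlr add)/(trans mz).
rewrite /abspart addrA [X in le _ X]addrC; apply/(ogleD2l add).
apply: pospart_lub; last by apply: addr_ge0 => //; exact: phi_ler01.
by rewrite zE opprB [X in le _ X]addrC; apply/(ogleD2l add).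
Qed.

(** The positive part [h] of [x - n] annihilates the negative part, so [h (x - n) = h^2 >= 0],
    whence [n h <= h x <= x^2]. *)
Lemma pospart_subr_nat x (n : nat) : le 0 x ->
  le (pospart (x - n%:R) *+ n) (x * x).
Proof.
move=> x0; set h := pospart (x - n%:R).
have hx : le h x.
  apply: (pospart_lub _ x0).
  by apply/(ogleBlr add)/(ogler_wDr add)/phi_natr_ge0.
apply: trans (phi_ler_wM2r x0 hx); rewrite -mulr_natr; apply/subr_ge0.
rewrite -mulrBr -[X in _ * X]pospartB mulrBr pospartMN subr0.
exact: phi_sqr_ge0.
Qed.

Lemma phi_commutator_bound a x : le 0 a -> le 0 x ->
  le (a * x - x * a) (a + a).
Proof.
move=> a0 x0; rewrite -[a + a]add0r; apply/(ogleBlr add (a + a)).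
apply: (@phi_arch _ (a * (x * x) + (x * x) * a)) => eps eps0.
(* With [n > eps^-1], the bound [x^2 / n] on the positive part of [x - n] is at most [eps x^2]. *)
pose n := Num.bound eps^-1.
have n_gt : eps^-1 < n%:R by apply: archi_boundP; rewrite invr_ge0 ltW.
have n_gt0 : 0 < n%:R :> R by apply: lt_trans n_gt; rewrite invr_gt0.
have [u /trans comm_u u_le] := phi_commutator_grid n a0 x0.
apply/(ogleBlr add)/comm_u => {comm_u}.
have h_le : le (pospart (x - n%:R)) (eps *:a (x * x)).
  have nK (h : ualg_module E) : n%:R^-1 *: (h *+ n) = h.
    by rewrite -scaler_nat scalerA mulVf ?gt_eqF // scale1r.
  have n_inv : n%:R^-1 <= eps.
    by rewrite -[eps]invrK lef_pV2 ?ltW // posrE invr_gt0.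
  rewrite -[pospart _]nK -ualg_scaleE.
  apply: (trans (phi_mono_scale _ (pospart_subr_nat n x0))).
    by rewrite invr_ge0 ltW.
  apply/subr_ge0; rewrite -ualg_scaleNl -ualg_scaleDl.
  by apply: phi_scale_ge0 (phi_sqr_ge0 x); rewrite Num.Theory.subr_ge0.
have {u_le h_le}u_le : le u (1 + eps *:a (x * x)).
  by apply: (trans u_le); apply/(ogleD2l add).
apply: (trans (ogleD ord add (phi_ler_wM2l a0 u_le) (phi_ler_wM2r a0 u_le))).
rewrite mulrDr mulrDl mulr1 mul1r addrACA addrC ualg_scaleDr.
rewrite -ualg_scaleAl -ualg_scaleAr.
exact: refl.
Qed.

(** The bound [a + a] does not depend on [x]: applied to [eps^-1 *:a x] and rescaled, it bounds the
    commutator by [eps *:a (a + a)]. *)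
Lemma phi_commutator_le a x : le 0 a -> le 0 x -> le (a * x) (x * a).
Proof.
move=> a0 x0; rewrite -[x * a]add0r; apply/(ogleBlr add).
apply: (@phi_arch _ (a + a)) => eps eps0.
have e0 : 0 <= eps^-1 by rewrite invr_ge0 ltW.
have bound := phi_commutator_bound a0 (phi_scale_ge0 e0 x0).
have := phi_mono_scale (ltW eps0) bound.
rewrite -ualg_scaleAl -ualg_scaleAr -ualg_scaleNr -ualg_scaleDr.
by rewrite ualg_scaleA mulfV ?gt_eqF // ualg_scale1.
Qed.

Lemma phi_mulC_pos a x : le 0 a -> le 0 x -> a * x = x * a.
Proof. by move=> a0 x0; apply: (ogle_anti ord); apply: phi_commutator_le. Qed.

Lemma phi_mulC : commutative (@GRing.mul E).
Proof.
have posC a x : le 0 a -> a * x = x * a.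
  move=> a0; rewrite -[x]pospartB mulrBr mulrBl.
  by congr (_ - _); apply: phi_mulC_pos.
by move=> a x; rewrite -[a]pospartB mulrBr mulrBl; congr (_ - _); apply: posC.
Qed.

(** * Radicality and the complexification *)

(** The negative part [n] of [b] satisfies [b n = - n^2]. Multiplying [a b >= 0] by [n] gives
    [eps n^2 <= a n^2 <= 0], so [n^2 = 0] and [n = 0]. *)
Lemma phi_coercive_cancel (eps : R) a b :
  0 < eps -> le (eps *:a 1) a -> le 0 (a * b) -> le 0 b.
Proof.
move=> eps0 a_ge ab0; set n := pospart (- b).
have bn : b * n = - (n * n) by rewrite -{1}(pospartB b) mulrBl pospartMN sub0r.
have nn0 := phi_sqr_ge0 n.
have eps_nn : le (eps *:a (n * n)) 0.
  apply: (trans (y := a * (n * n))).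
    by rewrite -{1}[n * n]mul1r ualg_scaleAl; exact: phi_ler_wM2r.
  rewrite -[n * n]opprK -bn mulrN -oppr0 mulrA; apply/(ogleN2 add).
  exact: (phi_mul_ge0 phi ab0 (pospart_ge0 _)).
have nn_le0 : le (n * n) 0.
  have := phi_mono_scale (_ : 0 <= eps^-1) eps_nn.
  rewrite ualg_scaleA mulVf ?gt_eqF // ualg_scale1 ualg_scaler0; apply.
  by rewrite invr_ge0 ltW.
have n0 : n = 0.
  by apply: phi_sqr_eq0; [exact: pospart_ge0 | exact: (ogle_anti ord)].
by rewrite -(pospartB b) -/n n0 subr0.
Qed.

Lemma phi_quadratic a b x : (x - a) * (x - b) = 0 ->
  x * x + a * b = x * (a + b).
Proof.
rewrite mulrBl !mulrBr opprB addrA => /eqP.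
rewrite subr_eq0 addrAC subr_eq => /eqP ->.
by rewrite (phi_mulC a x) mulrDr.
Qed.

Lemma cplx_mulC (x y : complexification E) : x * y = y * x.
Proof.
apply: cplx_eq => /=; first by rewrite [cre x * _]phi_mulC [cim x * _]phi_mulC.
by rewrite addrC [cre x * _]phi_mulC [cim x * _]phi_mulC.
Qed.

Lemma cplx_starM : cplx_star_antimorph E.
Proof.
move=> x y; rewrite cplx_mulC; apply: cplx_eq; rewrite /= ?mulrNN //.
by rewrite opprD mulrN mulNr.
Qed.

#[local] Notation EC := (cplx_starAlg cplx_starM).
#[local] Notation cle := (cplx_le le cplx_starM).

Lemma cim_herm (x : herm EC) : cim (herm_val x) = 0.
Proof. by have [r ->] := tens_herm_surj x; rewrite /= ualg_scale0. Qed.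

Lemma herm_cre_inj (x y : herm EC) :
  cre (herm_val x) = cre (herm_val y) -> x = y.
Proof. by move=> xy; apply/val_inj/cplx_eq => //=; rewrite !cim_herm. Qed.

Lemma cre_herm_scale (k : R) (x : herm EC) :
  cre (herm_val (k *: x)) = k *:a cre (herm_val x).
Proof. by rewrite /= ualg_scale0 subr0. Qed.

(** Conjugation acts as multiplication by the squared modulus of [d], a sum of squares and hence
    positive. *)
Lemma cre_herm_conj (d : EC) (x : herm EC) :
  cre (herm_val (herm_conj d x))
    = (cre d * cre d + cim d * cim d) * cre (herm_val x).
Proof.
rewrite /= cim_herm !mulr0 subr0 add0r !mulNr opprK.
rewrite mulrDl -!mulrA.
by congr (_ * _ + _ * _); apply: phi_mulC.
Qed.

Lemma cplx_ordered_star : ordered_star_algebra cle.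
Proof.
split; rewrite /cplx_le.
- split=> [x|x y z|x y xy yx]; [exact: refl|exact: trans|].
  by apply/herm_cre_inj/(ogle_anti ord).
- by move=> a b c; apply: add.
- move=> a b d ab; rewrite !cre_herm_conj; apply: phi_ler_wM2l ab.
  by apply: addr_ge0; exact: phi_sqr_ge0.
- exact: phi_ler01.
Qed.

Lemma tens_herm_quadratic a b x : x * x + a * b = x * (a + b) ->
  let h r := herm_val (tens_herm (starM := cplx_starM) r) in
  h x ^+ 2 + h a * h b = h x * (h a + h b).
Proof.
move=> xab /=; have [tD _ _] := @tens_bilinear R E.
rewrite expr2 [X in X + _]tensM [X in _ + X]tensM mulr1 -[LHS]tD xab.
by rewrite -[X in _ = _ * X]tD [RHS]tensM mulr1.
Qed.

Lemma cplx_phi_star : phi_star_algebra cle.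
Proof.
split; first exact: cplx_ordered_star.
- move=> v w vw; apply: (@phi_arch _ (cre (herm_val w))) => eps eps0.
  by rewrite -cre_herm_scale; exact: vw.
- move=> a b ab [eps eps0 epsa] ab0.
  apply: (@phi_coercive_cancel eps (cre (herm_val a))) => //.
    by move: epsa; rewrite /cplx_le cre_herm_scale.
  by move: ab0; rewrite /cplx_le /= !cim_herm mulr0 subr0.
- move=> a b _.
  have [r ->] := tens_herm_surj a; have [s ->] := tens_herm_surj b.
  have [x xsup] := riesz_sup (phi_riesz phi) r s; have [rx sx _] := xsup.
  exists (tens_herm x); split; first by move=> ? _; exact: cplx_mulC.
    (* For the supremum [x], the elements [x - r] and [x - s] are disjoint, so their product
       vanishes. *)
    exact/tens_herm_quadratic/phi_quadratic/phi_disj_mul/(is_inf_sup_sub add).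
  by rewrite /cplx_le mulr2n /= !ualg_scale1; apply: (ogleD ord add).
- move=> a b _.
  have [r ->] := tens_herm_surj a; have [s ->] := tens_herm_surj b.
  have [x xinf] := riesz_inf (phi_riesz phi) r s; have [xr xs _] := xinf.
  exists (tens_herm x); split; first by move=> ? _; exact: cplx_mulC.
    (* For the infimum [x], it is [r - x] and [s - x] that are disjoint, hence the two sign
       changes. *)
    apply/tens_herm_quadratic/phi_quadratic; rewrite -[LHS]mulrNN !opprB.
    by apply/phi_disj_mul; have := is_inf_subr add x xinf; rewrite subrr.
  by rewrite /cplx_le mulr2n /= !ualg_scale1; apply: (ogleD ord add).
Qed.

End PhiAlgebra.

Theorem proposition5p8 (R : realType) :
  (forall (E : unitalAlgType R) (le : relation E),
     phi_algebra le ->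
     (forall x y : complexification E, x * y = y * x) /\
     exists starM : cplx_star_antimorph E,
       phi_star_algebra (cplx_le le starM))
  /\
  (forall (A : comStarAlgType R) (le : relation (herm A)),
     phi_star_algebra le -> phi_algebra le).
Proof.
split=> [E le phi|A le]; last exact: phi_algebra_herm.
split; first exact: (cplx_mulC phi).
by exists (cplx_starM phi); exact: cplx_phi_star.
Qed.
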